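(* Consider the general additive Gaussian noise model: $Y = X + Z$ where $X \in \mathbb{R}^N$ is drawn from an arbitrary known prior (with all moments finite), $Z \in \mathbb{R}^N$ has i.i.d. $\mathcal{N}(0,1)$ entries independent of $X$, and $x \in \mathbb{R}$ is a scalar function of $X$ (with all joint moments with $X$ finite) to be estimated. Then for every integer $D \ge 0$, \[ \mathrm{Corr}_{\le D}^2 \le \sum_{\alpha \in \mathbb{N}^N,\ 0 \le |\alpha| \le D} \frac{\kappa_\alpha^2}{\alpha!}, \] where $\kappa_\alpha$ for $\alpha \in \mathbb{N}^N$ is defined recursively by \[ \kappa_\alpha = \mathbb{E}[x X^\alpha] - \sum_{0 \le \beta \lneq \alpha} \kappa_\beta \binom{\alpha}{\beta} \mathbb{E}[X^{\alpha-\beta}] \] (so in particular $\kappa_0 = \mathbb{E}[x]$).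
   Context: $\mathbb{N}=\{0,1,2,\dots\}$. For $\alpha \in \mathbb{N}^N$: $|\alpha| = \sum_i \alpha_i$, $\alpha! = \prod_i \alpha_i!$, $X^\alpha = \prod_i X_i^{\alpha_i}$; $\beta \le \alpha$ means $\beta_i \le \alpha_i$ for all $i$; $\beta \lneq \alpha$ means $\beta\le\alpha$ and $\beta\ne\alpha$; $\binom{\alpha}{\beta} = \prod_i \binom{\alpha_i}{\beta_i}$; $\alpha-\beta$ is entrywise. For an observation $Y$ and scalar target $x$ with joint law $\mathbb{P}$, the degree-$D$ maximum correlation is $\mathrm{Corr}_{\le D} = \sup\{ \mathbb{E}[f(Y)x]/\sqrt{\mathbb{E}[f(Y)^2]} : f \in \mathbb{R}[Y]_{\le D},\ \mathbb{E}[f(Y)^2]\neq 0\}$, where $\mathbb{R}[Y]_{\le D}$ is the space of real polynomials of degree at most $D$ in the coordinates of $Y$ and all expectations are over $\mathbb{P}$. The degree-$D$ minimum mean squared error is $\mathrm{MMSE}_{\le D} = \inf_{f \in \mathbb{R}[Y]_{\le D}} \mathbb{E}(f(Y)-x)^2$, and $\mathrm{MMSE}_{\le D} = \mathbb{E}[x^2] - \mathrm{Corr}_{\le D}^2$. *)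

(* Defs.v *)
From HB Require Import structures.
From mathcomp Require Import all_boot all_order all_algebra.
From mathcomp Require Import mpoly. (* must be imported before analysis: notation levels *)
From mathcomp Require Import all_classical all_reals all_analysis.

Set Implicit Arguments.
Unset Strict Implicit.
Unset Printing Implicit Defensive.

Import Order.TTheory GRing.Theory Num.Theory.
Local Open Scope classical_set_scope.
Local Open Scope ring_scope.

Section Defs.
Context (d : measure_display) (T : measurableType d) (R : realType)
  (P : probability T R).

(* Expectation of a real random variable (meaningful when integrable). *)
Definition Ex (f : T -> R) : R := fine (\int[P]_w (f w)%:E)%E.

Definition mnm (N : nat) (alpha : mpoly.multinom N) (i : 'I_N) : nat :=
  tnth (mpoly.multinom_val alpha) i.

Definition monom (N : nat) (alpha : mpoly.multinom N) (v : N.-tuple R) : R :=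
  \prod_(i < N) tnth v i ^+ mnm alpha i.

Definition mle (N : nat) (beta alpha : mpoly.multinom N) : bool :=
  [forall i, mnm beta i <= mnm alpha i]%N.

Definition mbinom (N : nat) (alpha beta : mpoly.multinom N) : nat :=
  (\prod_(i < N) 'C(mnm alpha i, mnm beta i))%N.

Definition mfact (N : nat) (alpha : mpoly.multinom N) : nat :=
  (\prod_(i < N) (mnm alpha i)`!)%N.

(* alpha - beta (entrywise; used only for beta <= alpha) *)
Definition msub (N : nat) (alpha beta : mpoly.multinom N) : mpoly.multinom N :=
  mpoly.Multinom [tuple (mnm alpha i - mnm beta i)%N | i < N].

Variables (N : nat) (X : T -> N.-tuple R) (x : T -> R).

(* kappa by recursion on the total degree, using fuel n >= |alpha|:
   kappa_alpha = E[x X^alpha]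
     - sum_{0 <= beta <= alpha, beta <> alpha} kappa_beta binom(alpha,beta) E[X^(alpha-beta)].
   Every beta <= alpha has |beta| <= |alpha|, so beta ranges over the finite
   type of monomials of degree < |alpha| + 1. *)
Fixpoint kappa_fuel (n : nat) (alpha : mpoly.multinom N) : R :=
  match n with
  | 0 => Ex (fun w => x w * monom alpha (X w))
  | n'.+1 =>
      Ex (fun w => x w * monom alpha (X w))
      - \sum_(beta : mpoly.bmultinom N (mpoly.mdeg alpha).+1
                | mle beta alpha && (mpoly.bmnm beta != alpha))
          kappa_fuel n' beta * (mbinom alpha beta)%:R
            * Ex (fun w => monom (msub alpha beta) (X w))
  end.

Definition kappa (alpha : mpoly.multinom N) : R :=
  kappa_fuel (mpoly.mdeg alpha) alpha.

Definition addt (u v : N.-tuple R) : N.-tuple R :=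
  [tuple tnth u i + tnth v i | i < N].

Definition CorrD (Y : T -> N.-tuple R) (D : nat) : \bar R :=
  ereal_sup [set (Ex (fun w => mpoly.meval (tnth (Y w)) f * x w)
                  / Num.sqrt (Ex (fun w => (mpoly.meval (tnth (Y w)) f) ^+ 2)))%:E
            | f in [set f : mpoly.mpoly N R |
                     (mpoly.msize f <= D.+1)%N /\
                     Ex (fun w => (mpoly.meval (tnth (Y w)) f) ^+ 2) != 0]].

End Defs.

(* Main.v *)
Require Import Defs.
From HB Require Import structures.
From mathcomp Require Import all_boot all_order all_algebra.
From mathcomp Require Import mpoly. (* must be imported before analysis: notation levels *)
From mathcomp Require Import all_classical all_reals all_analysis.
From mathcomp Require Import measurable_realfun ring lra zify.

Import Order.TTheory GRing.Theory Num.Theory.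
Local Open Scope classical_set_scope.
Local Open Scope ring_scope.

(** Let [He_b] be the Hermite polynomials and put
    [H = \sum_(|b| <= D) kappa_b / b! * He_b(Z)].  For every polynomial [f] of
    degree at most [D], [E[x f(Y)] = E[H f(Y)]]: on a monomial [Y^a], averaging
    over [Z] turns multiplication by [He_b(Z)] into the [b]-th derivative, and
    what remains is the recursion of [kappa], read as
    [E[x X^a] = \sum_b kappa_b binom(a, b) E[X^(a - b)]].  Since the [He_b(Z)]
    are orthogonal with squared norms [b!], [E[H^2]] is the bound of the
    theorem, and Cauchy-Schwarz for [H] and [f(Y)] gives the result. *)

(** For an arbitrary prior no orthogonal basis of polynomials in [Y] is available, so [H] is built
    from [Z] alone, whose Hermite polynomials are orthonormal up to factorials whatever the law of
    [X]. As [H] need not be a function of [Y], Cauchy-Schwarz gives only an upper bound. The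
    analytic obstacle is that independence is assumed on measurable rectangles, while expectations
    of [u(X) * \prod_i v_i(Z_i)] must factor for unbounded [u] and [v_i]. Instead of a product
    measure and Fubini, the proof absorbs a factor [v_k(Z_k)] into a signed integrable weight [W]:
    under [W * P] the other coordinates of [Z] are still independent Gaussians, so the factors can
    be split off one at a time. *)

(** * Image measures under a weight *)

Section Transfer.
Context d d' (T : measurableType d) (T' : measurableType d') (R : realType).
Variables (mu : {measure set T -> \bar R}) (nu : {measure set T' -> \bar R}).
Variable V : T -> T'.
Hypothesis mV : measurable_fun setT V.

Import HBNNSimple.

(** The last hypothesis says that [V] maps the measure with density [W] to [c * nu]. A simple
    function is a finite combination of indicators of its fibres, so linearity suffices. *)
Lemma ge0_integral_transfer_nnsfun (W : T -> R) (c : R) (g : {nnsfun T' >-> R}) :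
  measurable_fun setT W -> (forall w, 0 <= W w) -> 0 <= c ->
  (forall B, measurable B ->
    (\int[mu]_w (W w * \1_B (V w))%:E = c%:E * nu B)%E) ->
  (\int[mu]_w (W w * g (V w))%:E = c%:E * \int[nu]_y (g y)%:E)%E.
Proof.
move=> mW W0 c0 H.
have E1 w : (W w * g (V w))%:E =
    (\sum_(r \in range g) (r * (W w * \1_(g @^-1` [set r]) (V w)))%:E)%E.
  rewrite fsumEFin // (fimfunE g (V w)); congr EFin.
  rewrite !fsbig_finite //= mulr_sumr; apply: eq_bigr => r _.
  by rewrite mulrCA.
have mi (r : R) : measurable_fun setT (\1_(g @^-1` [set r]) \o V : T -> R).
  by apply: measurableT_comp => //; exact: measurable_indic.
have mWi (r : R) :
    measurable_fun setT (fun w => (W w * \1_(g @^-1` [set r]) (V w))%:E : \bar R).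
  apply/measurable_EFinP; apply: measurable_funM => //; exact: (mi r).
under eq_integral do rewrite E1.
rewrite ge0_integral_fsum //; last 2 first.
- move=> r; under eq_fun do rewrite EFinM.
  exact: measurable_funeM.
- move=> r w _; rewrite lee_fin mulrCA mulr_ge0 //.
  have [r0|r0] := leP 0 r; first by rewrite mulr_ge0.
  by rewrite preimage_nnfun0 // indic0 mulr0.
under [in RHS]eq_integral do rewrite fimfunE -fsumEFin //.
rewrite [in RHS]ge0_integral_fsum //; last 2 first.
- move=> r; apply/measurable_EFinP/measurable_funM => //.
- by move=> r y _; rewrite EFinM nnfun_muleindic_ge0.
rewrite ge0_mule_fsumr; last first.
  by move=> r; apply: integral_ge0 => y _; rewrite EFinM nnfun_muleindic_ge0.
apply: eq_fsbigr => r _.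
(* The fibre of a negative [r] is empty because [g] is nonnegative; only [0 <= r] may be pulled out
   of the integrals. *)
have [r0|r0] := leP 0 r; last first.
  rewrite preimage_nnfun0 //.
  under eq_integral do rewrite indic0 !mulr0.
  under [in RHS]eq_integral do rewrite indic0 mulr0.
  by rewrite !integral0 mule0.
under eq_integral do rewrite EFinM.
rewrite ge0_integralZl_EFin //; last first.
  by move=> w _; rewrite lee_fin mulr_ge0.
rewrite H //.
under [in RHS]eq_integral do rewrite EFinM.
rewrite [in RHS]ge0_integralZl_EFin //.
  by rewrite integral_indic // setIT muleCA.
exact/measurable_EFinP/measurable_indic.
Qed.

(** Monotone convergence on both sides, along increasing simple approximations of [v]. *)
Lemma ge0_integral_transfer (W : T -> R) (v : T' -> R) (c : R) :
  measurable_fun setT W -> (forall w, 0 <= W w) -> 0 <= c ->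
  (forall B, measurable B ->
    (\int[mu]_w (W w * \1_B (V w))%:E = c%:E * nu B)%E) ->
  measurable_fun setT v -> (forall y, 0 <= v y) ->
  (\int[mu]_w (W w * v (V w))%:E = c%:E * \int[nu]_y (v y)%:E)%E.
Proof.
move=> mW W0 c0 H mv v0.
have mv' : measurable_fun setT (EFin \o v : T' -> \bar R) by exact/measurable_EFinP.
pose g := nnsfun_approx measurableT mv'.
have gcvg y : (EFin \o g ^~ y) @ \oo --> (v y)%:E.
  by apply: (cvg_nnsfun_approx measurableT mv') => // t _; rewrite lee_fin.
have gnd y : {homo (fun n => g n y) : m n / (m <= n)%N >-> m <= n}.
  by move=> m n mn; apply/lefP/nd_nnsfun_approx.
have L1 : (\int[mu]_w (W w * g n (V w))%:E)%E @[n --> \oo] -->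
    (\int[mu]_w (W w * v (V w))%:E)%E.
  have -> : (\int[mu]_w (W w * v (V w))%:E =
      \int[mu]_w limn (fun n => (W w * g n (V w))%:E))%E.
    apply: eq_integral => w _; apply/esym/cvg_lim => //.
    under eq_fun do rewrite EFinM.
    rewrite EFinM; apply: cvgeZl => //; exact: gcvg.
  apply: cvg_monotone_convergence => //.
  - move=> n; apply/measurable_EFinP/measurable_funM => //.
    exact: measurableT_comp.
  - by move=> n w _; rewrite lee_fin mulr_ge0.
  - by move=> w _ m n mn; rewrite lee_fin ler_wpM2l // gnd.
have L2 : (\int[mu]_w (W w * g n (V w))%:E)%E @[n --> \oo] -->
    (c%:E * \int[nu]_y (v y)%:E)%E.
  under eq_fun => n do rewrite (@ge0_integral_transfer_nnsfun W c (g n) mW W0 c0 H).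
  apply: cvgeZl => //.
  have -> : (\int[nu]_y (v y)%:E =
      \int[nu]_y limn (fun n => (g n y)%:E))%E.
    apply: eq_integral => y _; apply/esym/cvg_lim => //; exact: gcvg.
  apply: cvg_monotone_convergence => //.
  - by move=> n; exact/measurable_EFinP.
  - by move=> n w _; rewrite lee_fin.
  - by move=> w _ m n mn; rewrite lee_fin gnd.
exact: (cvg_unique _ L1 L2).
Qed.

(* Both [W] and [|W|] are controlled so that the positive and the negative
   part of [W] each satisfy the hypothesis. *)
Lemma integral_transfer (W : T -> R) (v : T' -> R) (c c' : R) :
  mu.-integrable setT (EFin \o W) ->
  (forall B, measurable B ->
    (\int[mu]_w (W w * \1_B (V w))%:E = c%:E * nu B)%E) ->
  (forall B, measurable B ->
    (\int[mu]_w (`|W w| * \1_B (V w))%:E = c'%:E * nu B)%E) ->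
  (nu setT = 1)%E ->
  nu.-integrable setT (EFin \o v) ->
  mu.-integrable setT (fun w => (W w * v (V w))%:E) /\
  (\int[mu]_w (W w * v (V w))%:E = c%:E * \int[nu]_y (v y)%:E)%E.
Proof.
move=> iW H H' nu1 iv.
have mW : measurable_fun setT W by exact/measurable_EFinP/(measurable_int mu).
have mv : measurable_fun setT v by exact/measurable_EFinP/(measurable_int nu).
have nufin B : measurable B -> nu B \is a fin_num.
  move=> mB; rewrite ge0_fin_numE // (@le_lt_trans _ _ (nu setT)) ?nu1 ?ltry //.
  by rewrite -nu1; apply: le_measure; rewrite ?inE.
(* For [s = 1] and [s = -1], [f (W w)] is the positive and the negative part of [W]; the constant
   [cs] is the same combination of [c'] and [c]. *)
have part (s : R) : (s = 1 \/ s = -1) -> forall f : R -> R,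
    (forall r, f r = 2^-1 * (`|r| + s * r)) ->
    let cs := 2^-1 * (c' + s * c) in
    (forall v : T' -> R, measurable_fun setT v -> (forall y, 0 <= v y) ->
    (\int[mu]_w (f (W w) * v (V w))%:E = cs%:E * \int[nu]_y (v y)%:E)%E).
  move=> hs f fE cs u mu_ u0.
  have f0 r : 0 <= f r.
    by rewrite fE; case: hs => ->; rewrite ?mul1r ?mulN1r mulr_ge0 //;
      [have := ler_norm (- r); rewrite normrN|have := ler_norm r]; lra.
  have iWB B : measurable B ->
      mu.-integrable setT (fun w => (W w * \1_B (V w))%:E).
    move=> mB; apply: (le_integrable measurableT _ _ iW) => /=.
      apply/measurable_EFinP/measurable_funM => //.
      by apply: measurableT_comp => //; exact: measurable_indic.
    move=> w _; rewrite lee_fin normrM ler_piMr // indicE.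
    by case: (_ \in _); rewrite ?normr1 ?normr0.
  have iWB' B : measurable B ->
      mu.-integrable setT (fun w => (`|W w| * \1_B (V w))%:E).
    move=> mB; apply: (le_integrable measurableT _ _ (iWB B mB)) => /=.
      apply/measurable_EFinP/measurable_funM => //.
        exact: measurableT_comp.
      by apply: measurableT_comp => //; exact: measurable_indic.
    by move=> w _; rewrite !normrM normr_id.
  have Hs B : measurable B ->
      (\int[mu]_w (f (W w) * \1_B (V w))%:E = cs%:E * nu B)%E.
    move=> mB; rewrite (_ : (fun w => _) = (fun w => (2^-1)%:E *
       ((`|W w| * \1_B (V w))%:E + s%:E * (W w * \1_B (V w))%:E))%E); last first.
      apply/funext => w.
      transitivity (2^-1 * (`|W w| * \1_B (V w) + s * (W w * \1_B (V w))))%:E => //.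
      by congr EFin; rewrite fE; ring.
    rewrite integralZl //; last first.
      by apply: integrableD => //; [exact: iWB'|exact: integrableZl (iWB _ mB)].
    rewrite integralD //; [|exact: iWB'|exact: integrableZl (iWB _ mB)].
    rewrite integralZl //; last exact: iWB.
    rewrite H // H' // -(fineK (nufin _ mB)); set n := fine _.
    transitivity (2^-1 * (c' * n + s * (c * n)))%:E => //.
    by rewrite -EFinM; congr EFin; rewrite /cs; ring.
  have mf : measurable_fun setT (f \o W).
    rewrite (_ : _ \o _ = fun w => 2^-1 * (`|W w| + s * W w)); last first.
      by apply/funext => w /=.
    apply: measurable_funM => //; apply: measurable_funD => //.
      exact: measurableT_comp.
    exact: measurable_funM.
  apply: (@ge0_integral_transfer (f \o W)) => //=.
  (* As [nu] has mass 1, [cs] is the integral of a nonnegative weight, hence nonnegative. *)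
  have := Hs setT measurableT; rewrite nu1 mule1 => h.
  by rewrite -lee_fin -h; apply: integral_ge0 => w _; rewrite lee_fin mulr_ge0.
have := part 1 (or_introl erefl) (fun r => 2^-1 * (`|r| + 1 * r)) (fun=> erefl).
have := part (-1) (or_intror erefl) (fun r => 2^-1 * (`|r| + -1 * r)) (fun=> erefl).
clear part => /=.
set fn := fun r : R => 2^-1 * (`|r| + -1 * r).
set fp := fun r : R => 2^-1 * (`|r| + 1 * r).
set cn := 2^-1 * _; set cp := 2^-1 * _ => Hn Hp.
have fpn r : r = fp r - fn r by rewrite /fp /fn; field.
have mfp : measurable_fun setT (fp \o W).
  apply: measurable_funM => //; apply: measurable_funD => //.
    exact: measurableT_comp.
  exact: measurable_funM.
have mfn : measurable_fun setT (fn \o W).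
  apply: measurable_funM => //; apply: measurable_funD => //.
    exact: measurableT_comp.
  exact: measurable_funM.
have f0p r : 0 <= fp r.
  by rewrite /fp mulr_ge0 //; have := ler_norm (- r); rewrite normrN; lra.
have f0n r : 0 <= fn r.
  by rewrite /fn mulr_ge0 //; have := ler_norm r; lra.
(* With a nonnegative weight fixed, a signed [v] is handled by splitting it in turn. *)
have sg (f : R -> R) (cs : R) :
    measurable_fun setT (f \o W) -> (forall r, 0 <= f r) ->
    (forall v : T' -> R, measurable_fun setT v -> (forall y, 0 <= v y) ->
      (\int[mu]_w (f (W w) * v (V w))%:E = cs%:E * \int[nu]_y (v y)%:E)%E) ->
    mu.-integrable setT (fun w => (f (W w) * v (V w))%:E) /\
    (\int[mu]_w (f (W w) * v (V w))%:E = cs%:E * \int[nu]_y (v y)%:E)%E.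
  move=> mf f0 Hf.
  have ivp : nu.-integrable setT (EFin \o v^\+).
    exact: integrable_funrpos.
  have ivn : nu.-integrable setT (EFin \o v^\-).
    exact: integrable_funrneg.
  have mvp : measurable_fun setT v^\+ by exact: measurable_funrpos.
  have mvn : measurable_fun setT v^\- by exact: measurable_funrneg.
  have aux (u : T' -> R) : measurable_fun setT u -> (forall y, 0 <= u y) ->
      nu.-integrable setT (EFin \o u) ->
      mu.-integrable setT (fun w => (f (W w) * u (V w))%:E).
    move=> mu_ u0 iu; apply/integrableP; split.
      by apply/measurable_EFinP/measurable_funM => //; exact: measurableT_comp.
    under eq_integral do rewrite gee0_abs ?lee_fin ?mulr_ge0 //.
    rewrite Hf // -(fineK (integrable_fin_num _ iu)) //.
    by rewrite -EFinM ltry.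
  have ip := aux _ mvp (@funrpos_ge0 _ _ v) ivp.
  have in_ := aux _ mvn (@funrneg_ge0 _ _ v) ivn.
  have vE y : v y = v^\+ y - v^\- y.
    by rewrite -[in LHS](funrposBneg v).
  have E1 : (fun w => (f (W w) * v (V w))%:E) =
     (fun w => (f (W w) * v^\+ (V w))%:E - (f (W w) * v^\- (V w))%:E)%E.
    by apply/funext => w; rewrite -EFinB -mulrBr -vE.
  rewrite E1; split; first exact: integrableB.
  rewrite integralB // !Hf //.
  have E2 : (\int[nu]_y (v y)%:E = \int[nu]_y (v^\+ y)%:E - \int[nu]_y (v^\- y)%:E)%E.
    by rewrite -integralB //; apply: eq_integral => y _ /=; rewrite vE EFinB.
  rewrite E2.
  move: (integrable_fin_num measurableT ivp) (integrable_fin_num measurableT ivn).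
  rewrite /= => /fineK <- /fineK <-.
  set n := fine _; set m := fine _.
  transitivity (cs * n - cs * m)%:E => //.
  by rewrite -mulrBr.
have [ip Ep] := sg fp cp mfp f0p Hp.
have [in_ En] := sg fn cn mfn f0n Hn.
have E1 : (fun w => (W w * v (V w))%:E) =
     (fun w => (fp (W w) * v (V w))%:E - (fn (W w) * v (V w))%:E)%E.
  by apply/funext => w; rewrite -EFinB -mulrBl -fpn.
rewrite E1; split; first exact: integrableB.
rewrite integralB // Ep En.
have /= := integrable_fin_num measurableT iv => /fineK <-.
set n := fine _; transitivity (cp * n - cn * n)%:E => //.
by rewrite -EFinM; congr EFin; rewrite /cp /cn; field.
Qed.

End Transfer.

(** * Gaussian means of polynomials and Stein's identity *)

Section GaussianMoments.
Set Implicit Arguments.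
Unset Strict Implicit.
Import numFieldNormedType.Exports.
Variable R : realType.
Implicit Types (p : {poly R}) (n : nat).

Local Notation mu := (@lebesgue_measure R).
Local Notation gauss := (normal_prob (0 : R) 1).
Local Notation phi := (normal_pdf (0 : R) 1).

Definition gmean p : R := Ex gauss (horner p).

(** One exponential factor will absorb powers of [t]; the other is a multiple of the Gaussian
    density of variance 2, hence integrable. *)
Lemma normal_pdf01E (t : R) :
  phi t = normal_peak 1 * (expR (- t ^+ 2 / 4) * expR (- t ^+ 2 / 4)).
Proof.
rewrite normal_pdfE ?oner_eq0 // /normal_fun subr0 -expRD.
by congr (_ * expR _); field.
Qed.

Lemma normal_pdf0_sqrt2E (t : R) :
  expR (- t ^+ 2 / 4) = (normal_peak (Num.sqrt 2))^-1 * normal_pdf 0 (Num.sqrt 2) t.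
Proof.
have s2 : Num.sqrt (2 : R) != 0 by rewrite gt_eqF // sqrtr_gt0.
rewrite normal_pdfE //= mulrA mulVf ?gt_eqF ?normal_peak_gt0 // mul1r /normal_fun subr0.
by rewrite sqr_sqrtr //; congr expR; field.
Qed.

Lemma power_expR_bound n :
  exists2 C : R, 0 <= C & forall t : R, `|t ^+ n| * expR (- t ^+ 2 / 4) <= C.
Proof.
(* The summand 1 covers [|t| <= 1]. Otherwise [|t|^n] is at most [(4 y)^(n+1)] with [y = t^2 / 4],
   and [y^(n+1) <= (n+1)! e^y]. *)
exists (1 + n.+1`!%:R * 4 ^+ n.+1) => [|t].
  by rewrite addr_ge0 // mulr_ge0 // exprn_ge0.
set y := t ^+ 2 / 4; have y0 : 0 <= y by rewrite divr_ge0 // sqr_ge0.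
have -> : - t ^+ 2 / 4 = - y by rewrite mulNr.
rewrite expRN ler_pdivrMr ?expR_gt0 //.
have h1 : y ^+ n.+1 <= n.+1`!%:R * expR y.
  rewrite mulrC -ler_pdivrMr ?ltr0n ?fact_gt0 //.
  by apply: le_trans (expR_ge1Dxn n y0); rewrite lerDr.
have h2 : `|t| ^+ (n.+1 * 2) <= n.+1`!%:R * 4 ^+ n.+1 * expR y.
  rewrite mulnC exprM -normrX ger0_norm ?sqr_ge0 //.
  have -> : t ^+ 2 = 4 * y by rewrite /y; field.
  by rewrite exprMn mulrAC mulrC ler_pM2r // exprn_gt0.
have e1 : 1 <= expR y by rewrite -[1]expR0 ler_expR.
rewrite normrX mulrDl mul1r.
have [t1|t1] := leP `|t| 1.
  apply: (@le_trans _ _ 1); first exact: exprn_ile1.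
  by rewrite (le_trans e1) // lerDl !mulr_ge0 // ?exprn_ge0 // expR_ge0.
apply: (@le_trans _ _ (`|t| ^+ (n.+1 * 2))).
  by rewrite ler_weXn2l ?(ltW t1) // mulSn muln2; lia.
by apply: (le_trans h2); rewrite lerDr expR_ge0.
Qed.

Lemma integrable_poly_pdf p :
  mu.-integrable setT (fun t => (p.[t] * phi t)%:E).
Proof.
have mono n : mu.-integrable setT (fun t => (t ^+ n * phi t)%:E).
  have [C C0 HC] := power_expR_bound n.
  have s2 : Num.sqrt (2 : R) != 0 by rewrite gt_eqF // sqrtr_gt0.
  set K := normal_peak 1 * C * (normal_peak (Num.sqrt 2))^-1.
  have iK : mu.-integrable setT (fun t => K%:E * (normal_pdf 0 (Num.sqrt 2) t)%:E)%E.
    exact/integrableZl/integrable_normal_pdf.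
  apply: le_integrable iK => //=.
    apply/measurable_EFinP/measurable_funM => //.
    exact: measurable_normal_pdf.
  move=> t _; rewrite lee_fin normal_pdf01E.
  have g0 := expR_ge0 (- t ^+ 2 / 4).
  have pk1 : 0 <= normal_peak (1 : R) by exact: normal_peak_ge0.
  rewrite (ger0_norm (mulr_ge0 _ (normal_pdf_ge0 _ _ _))); last first.
    by rewrite /K !mulr_ge0 // invr_ge0 normal_peak_ge0.
  rewrite /K -!mulrA -normal_pdf0_sqrt2E !normrM !(ger0_norm g0) (ger0_norm pk1).
  by rewrite mulrCA ler_wpM2l // mulrA ler_wpM2r // -normrM.
have -> : (fun t => (p.[t] * phi t)%:E) =
    (fun t => \sum_(i < size p) (p`_i)%:E * (t ^+ i * phi t)%:E)%E.
  apply/funext => t; rewrite horner_coef mulr_suml -sumEFin.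
  by apply: eq_bigr => i _; rewrite -EFinM mulrA.
by apply: integrable_sum => // i _; apply: integrableZl.
Qed.

Lemma gauss_transfer (B : set R) : measurable B ->
  (\int[mu]_t (phi t * \1_B t)%:E = 1%:E * gauss B)%E.
Proof.
move=> mB; rewrite mul1e /normal_prob [in RHS]integral_mkcond.
apply: eq_integral => t _; rewrite patchE indicE.
by case: (t \in B); rewrite ?mulr1 ?mulr0.
Qed.

Lemma integrable_gauss_poly p : gauss.-integrable setT (fun t => (p.[t])%:E).
Proof.
have mp : measurable_fun setT (horner p : R -> R) by exact: measurable_poly.
apply/integrableP; split; first exact/measurable_EFinP.
have := integrable_poly_pdf p => /integrableP[_].
under eq_integral => t _ do
  rewrite abse_EFin normrM (ger0_norm (normal_pdf_ge0 _ _ _)) mulrC.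
rewrite (@ge0_integral_transfer _ _ _ _ R mu gauss id _ phi (fun t => `|p.[t]|) 1) //.
- by rewrite mul1e.
- exact: measurable_normal_pdf.
- exact: normal_pdf_ge0.
- exact: gauss_transfer.
- exact: measurableT_comp.
Qed.

(** Moves the mean to Lebesgue measure, where the fundamental theorem of calculus applies. *)
Lemma gmeanE p : (gmean p)%:E = (\int[mu]_t (p.[t] * phi t)%:E)%E.
Proof.
rewrite /gmean /Ex fineK; last first.
  exact: (integrable_fin_num measurableT (integrable_gauss_poly p)).
have phiE t : `|phi t| = phi t by rewrite ger0_norm // normal_pdf_ge0.
have [] := @integral_transfer _ _ _ _ R mu gauss id _ phi (horner p) 1 1.
- exact: measurable_id.
- exact: integrable_normal_pdf.
- exact: gauss_transfer.
- by move=> B mB; under eq_integral do rewrite phiE; exact: gauss_transfer.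
- exact: probability_setT.
- exact: integrable_gauss_poly.
by move=> _; rewrite mul1e => <-; apply: eq_integral => t _; rewrite mulrC.
Qed.

Lemma gmean_linear : linear_for *%R gmean.
Proof.
move=> a p q; apply: EFin_inj; rewrite EFinD EFinM !gmeanE.
have ip := integrable_poly_pdf p; have iq := integrable_poly_pdf q.
rewrite -(integralZl measurableT ip) -(integralD measurableT _ iq); last first.
  exact: integrableZl.
apply: eq_integral => t _; rewrite hornerD hornerZ.
by rewrite mulrDl EFinD -mulrA EFinM.
Qed.

HB.instance Definition _ :=
  GRing.isLinear.Build R {poly R} R *%R gmean gmean_linear.

Lemma gmean1 : gmean 1 = 1.
Proof.
apply: EFin_inj; rewrite gmeanE; under eq_integral do rewrite hornerC mul1r.
exact: integral_normal_pdf.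
Qed.

Lemma is_derive_poly_normal_pdf p (t : R) :
  is_derive t 1 (fun t => p.[t] * phi t) ((p^`() - 'X * p).[t] * phi t).
Proof.
have phiE : phi = fun t => normal_peak 1 * expR (- t ^+ 2 / 2).
  apply/funext => u; rewrite normal_pdfE ?oner_eq0 //= /normal_fun subr0.
  by congr (_ * expR _); field.
have dsq : is_derive t 1 (fun t : R => - t ^+ 2 / 2) (- t).
  rewrite (_ : (fun t => _) = horner ((- 2^-1) *: 'X^2)); last first.
    by apply/funext => u; rewrite hornerZ hornerXn !mulNr mulrC.
  have h := is_derive_poly ((- 2^-1) *: 'X^2) t; apply: (is_derive_eq h).
  by rewrite derivZ derivXn hornerZ hornerMn hornerXn; field.
have dphi : is_derive t 1 phi (- t * phi t).
  rewrite phiE.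
  have de := @is_derive1_comp R expR (fun t => - t ^+ 2 / 2) t _ _
    (is_derive_expR (- t ^+ 2 / 2)) dsq.
  have := is_deriveM (is_derive_cst (normal_peak 1 : R) t 1) de.
  move=> h; apply: (is_derive_eq h) => /=.
  by rewrite scaler0 addr0 /GRing.scale /=; ring.
have dp := is_derive_poly p t.
have h := is_deriveM dp dphi.
apply: (is_derive_eq h).
by rewrite /GRing.scale /= hornerD hornerN hornerM hornerX; ring.
Qed.

(** Applying a uniform bound on polynomials times [phi] to [p * 'X] shows that [p * phi] decays like
    [1 / |t|]. Integer points suffice for the boundary terms of Stein's identity. *)
Lemma cvg_poly_normal_pdf p :
  (fun n => p.[n%:R] * phi n%:R) @ \oo --> (0 : R) /\
  (fun n => p.[- n%:R] * phi (- n%:R)) @ \oo --> (0 : R).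
Proof.
have [C HC] : exists C : R, forall t : R, `|p.[t] * phi t * t| <= C.
  have H q : exists C : R, forall t : R, `|q.[t] * phi t| <= C.
    have Hm n : exists C : R, forall t : R, `|t ^+ n * phi t| <= C.
      have [C C0 HC] := power_expR_bound n.
      exists (normal_peak 1 * C) => t.
      rewrite normal_pdf01E !normrM (ger0_norm (normal_peak_ge0 _)).
      rewrite !(ger0_norm (expR_ge0 _)) mulrCA ler_wpM2l ?normal_peak_ge0 //.
      apply: le_trans (HC t); rewrite ler_wpM2l //.
      rewrite -[leRHS]mulr1 ler_wpM2l ?expR_ge0 //.
      by rewrite -[leRHS]expR0 ler_expR mulNr oppr_le0 divr_ge0 // sqr_ge0.
    have [C HC] := choice Hm.
    exists (\sum_(i < size q) `|q`_i| * C i) => t.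
    rewrite horner_coef mulr_suml (le_trans (ler_norm_sum _ _ _)) //.
    by apply: ler_sum => i _; rewrite -mulrA normrM ler_wpM2l.
  have [C HC] := H (p * 'X); exists C => t.
  by have := HC t; rewrite hornerMX mulrAC.
have lim0 (u : nat -> R) : (forall n, `|u n| = n%:R) ->
    (fun n => p.[u n] * phi (u n)) @ \oo --> (0 : R).
  move=> hu; apply/cvgrPdist_le => e e0; near=> n.
  have n0 : (0 : R) < n%:R by rewrite ltr0n; near: n; exists 1%N.
  rewrite sub0r normrN -(ler_pM2r n0) -[X in _ * X <= _]hu -normrM.
  apply: (le_trans (HC _)); rewrite mulrC -ler_pdivrMr //.
  by near: n; exact: nbhs_infty_ger.
split; apply: lim0 => n; rewrite ?normrN normr_nat //.
Unshelve. all: by end_near. Qed.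

(** Integration by parts: the integrand of the difference is the derivative of [p * phi]. Its
    integrals over growing intervals tend to 0 by decay at the endpoints, and to the full integral
    by dominated convergence. *)
Lemma gmean_stein p : gmean p^`() = gmean ('X * p).
Proof.
apply/eqP; rewrite -subr_eq0 -linearB /=; apply/eqP.
set q := _ - _; pose f (t : R) := q.[t] * phi t; pose F (t : R) := p.[t] * phi t.
have dF (t : R) : is_derive t 1 F (f t) by exact: is_derive_poly_normal_pdf.
have cF : continuous F.
  by move=> t; apply: differentiable_continuous; apply/derivable1_diffP.
have cf : continuous f.
  move=> t; apply: cvgM; first exact: continuous_horner.
  by apply: continuous_normal_pdf; rewrite oner_eq0.
(* [n.+1] keeps the interval nondegenerate at [n = 0], as the fundamental theorem requires. *)
pose I n : set R := [set` `[- n.+1%:R : R, n.+1%:R]].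
have ftc n : (\int[mu]_(t in I n) (f t)%:E =
    (F n.+1%:R - F (- n.+1%:R))%:E)%E.
  rewrite EFinB; apply: continuous_FTC2.
  - by rewrite gtrN // ltr0n.
  - by apply: continuous_subspaceT.
  - split.
    + by move=> t _.
    + by apply: cvg_at_right_filter; exact: cF.
    + by apply: cvg_at_left_filter; exact: cF.
  - by move=> t _; rewrite derive1E derive_val.
have [Fp Fn] := cvg_poly_normal_pdf p.
have L1 : (fun n => \int[mu]_(t in I n) (f t)%:E)%E @ \oo --> 0%E.
  under eq_fun do rewrite ftc.
  apply: cvg_EFin; first by near=> n.
  rewrite -(subr0 0); apply: (@cvgB _ R^o).
    by have := Fp; rewrite -cvg_shiftS.
  by have := Fn; rewrite -cvg_shiftS.
have if_ : mu.-integrable setT (EFin \o f) by exact: integrable_poly_pdf.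
have mf : measurable_fun setT (EFin \o f) by exact: (measurable_int mu).
have L2 : (fun n => \int[mu]_(t in I n) (f t)%:E)%E @ \oo -->
    (\int[mu]_t (f t)%:E)%E.
  under eq_fun do rewrite integral_mkcond.
  have [] := @dominated_convergence _ _ R mu setT measurableT
    (fun n => (EFin \o f) \_ (I n)) (EFin \o f) (abse \o (EFin \o f)).
  - move=> n; apply/(measurable_restrictT (EFin \o f) (measurable_itv _)).
    exact: measurable_funTS.
  - exact: mf.
  - apply/nearW => t _; apply: cvg_near_cst; near=> n.
    rewrite patchE mem_set //= /I /= in_itv /= -ler_norml.
    apply: (@le_trans _ _ n%:R); last by rewrite ler_nat.
    by near: n; exact: nbhs_infty_ger.
  - exact: integrable_abse.
  - apply/nearW => t n _; rewrite patchE; case: ifP => _; first exact: lexx.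
    by rewrite abse0 abse_ge0.
  by move=> _ _.
apply: EFin_inj; rewrite gmeanE; exact: (cvg_unique _ L2 L1).
Unshelve. all: by end_near. Qed.

End GaussianMoments.

(** * Hermite polynomials and a binomial identity *)

Section Hermite.
Set Implicit Arguments.
Unset Strict Implicit.
Variable R : realType.
Implicit Types (p q : {poly R}) (m n : nat).

Fixpoint hermite n : {poly R} :=
  if n is n'.+1 then 'X * hermite n' - (hermite n')^`() else 1.

Lemma gmean_hermite n p : gmean (hermite n * p) = gmean p^`(n).
Proof.
elim: n p => [|n IHn] p; first by rewrite /= mul1r.
rewrite derivSn -IHn [hermite _.+1]/= mulrBl -mulrA linearB /= -gmean_stein.
rewrite derivM linearD /=.
by rewrite addrAC subrr add0r.
Qed.

Lemma deriv_hermite n : (hermite n)^`() = hermite n.-1 *+ n.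
Proof.
elim: n => [|n IHn] /=; first by rewrite derivC mulr0n.
rewrite IHn derivB derivM derivX mul1r IHn derivMn -addrA.
case: n {IHn} => [|n] /=; first by rewrite !mulr0n mulr0 subr0 addr0.
by rewrite mulrnAr -mulrnBl -mulrS.
Qed.

Lemma derivn_hermite m n : (hermite n)^`(m) = hermite (n - m) *+ n ^_ m.
Proof.
elim: m => [|m IHm]; first by rewrite derivn0 subn0 ffactn0.
rewrite derivnS IHm derivMn deriv_hermite -mulrnA subnS mulnC.
by rewrite ffactnSr.
Qed.

(** With [n <= m], the mean is that of the [m]-th derivative of [hermite n]: zero if [n < m], and
    [n!] if [m = n]. *)
Lemma gmean_hermite_orthogonal m n :
  gmean (hermite m * hermite n) = (n`! * (m == n))%:R.
Proof.
wlog mn : m n / (n <= m)%N.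
  move=> h; have [/h//|/ltnW/h] := leqP n m.
  by rewrite mulrC => ->; case: eqVneq => [->//|_]; rewrite ?muln1 ?muln0.
rewrite gmean_hermite derivn_hermite; case: (ltngtP n m) mn => // [nm|->] _.
  by rewrite ffact_small // mulr0n linear0 muln0.
by rewrite subnn linearMn /= gmean1 ffactnn muln1.
Qed.

Lemma gmean_hermite_exp b n :
  gmean (hermite b * 'X^n) = (n ^_ b)%:R * gmean 'X^(n - b).
Proof. by rewrite gmean_hermite derivnXn linearMn /= mulr_natl. Qed.

(** Both sides are the multinomial coefficient [a! / (j! b! (a - j - b)!)]. *)
Lemma bin_shift a b j : (j + b <= a)%N ->
  ('C(j + b, b) * 'C(a, j + b) = 'C(a, j) * 'C(a - j, b))%N.
Proof.
move=> jba; apply/eqP.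
have f0 : (0 < j`! * b`! * (a - j - b)`!)%N by rewrite !muln_gt0 !fact_gt0.
rewrite -(eqn_pmul2r f0); apply/eqP.
have e1 := bin_fact (leq_trans (leq_addr b j) jba).
have e2 := @bin_fact (a - j) b; rewrite leq_subRL in e2; last by lia.
have e3 := bin_fact jba; rewrite subnDA in e3.
have e4 := bin_fact (leq_addl j b); rewrite addnK in e4.
transitivity (a`!); first by rewrite -e3 -e4; lia.
by rewrite -e1 -e2 //; lia.
Qed.

(* When [m] is the sequence of Gaussian moments, both sides are [b!^-1] times
   the mean over [z] of [hermite b] at [z] times [(t + z) ^ a]. *)
Lemma binomial_shift a b K (m : nat -> R) (t : R) : (a < K)%N ->
  \sum_(j < K) t ^+ (j - b) * ('C(j, b) * 'C(a, j))%:R * m (a - j)%N =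
  \sum_(j < K) t ^+ j * ('C(a, j) * 'C(a - j, b))%:R * m (a - j - b)%N.
Proof.
move=> aK.
pose F j := t ^+ (j - b) * ('C(j, b) * 'C(a, j))%:R * m (a - j)%N.
pose G j := t ^+ j * ('C(a, j) * 'C(a - j, b))%:R * m (a - j - b)%N.
rewrite -(big_mkord xpredT F) -(big_mkord xpredT G) /=.
(* Wherever a natural subtraction is truncated, a binomial coefficient vanishes; elsewhere the sums
   agree after shifting the index by [b]. *)
have Fs j : (j < b)%N -> F j = 0.
  by move=> jb; rewrite /F bin_small // mul0n mulr0 mul0r.
have Gs j : (a < j + b)%N -> G j = 0.
  move=> jb; rewrite /G; have [aj|ja] := ltnP a j.
    by rewrite bin_small // mul0n mulr0 mul0r.
  by rewrite (@bin_small (a - j)) ?muln0 ?mulr0 ?mul0r //; lia.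
have FG j : F (j + b)%N = G j.
  have [jb|jb] := ltnP a (j + b).
    by rewrite Gs // /F (@bin_small a) // muln0 mulr0 mul0r.
  rewrite /F /G addnK subnDA; congr (_ * _%:R * _).
  exact: bin_shift.
have [Kb|bK] := leqP K b.
  rewrite !big_nat !big1 // => j /andP[_ jK]; first by rewrite Gs //; lia.
  by rewrite Fs //; lia.
rewrite (big_cat_nat (n := b)) ?(ltnW bK) //= big_nat big1 ?add0r; last first.
  by move=> j /andP[_ /Fs].
(* The shift shortens the left range to [K - b]; the surplus terms on the right vanish since
   [a < K <= j + b]. *)
rewrite -{1}(add0n b) big_addn [RHS](big_cat_nat (n := K - b)) ?leq_subr //=.
rewrite [X in _ = _ + X]big_nat [X in _ = _ + X]big1 ?addr0; last first.
  by move=> j /andP[jK _]; rewrite Gs //; lia.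
by apply: eq_bigr => j _; rewrite FG.
Qed.

End Hermite.

(** * Factorisation of expectations over signal and noise *)

Section Independence.
Set Implicit Arguments.
Unset Strict Implicit.
Context d (T : measurableType d) (R : realType) (P : probability T R) (N : nat).
Variables (Z : T -> N.-tuple R).
Hypothesis mZ : measurable_fun setT Z.
Implicit Types (W : T -> R) (s : seq 'I_N) (B : 'I_N -> set R).

Local Notation gauss := (normal_prob (0 : R) 1).

Let mZi i : measurable_fun setT (fun w => tnth (Z w) i).
Proof. by move/measurable_fun_tnthP : mZ => /(_ i). Qed.

Definition noise_box s B (w : T) : R := \prod_(i <- s) \1_(B i) (tnth (Z w) i).

(* Under the signed measure [W * P], the coordinates of [Z] in [s] are
   independent standard Gaussians. *)
Definition indep_noise W s :=
  P.-integrable setT (EFin \o W) /\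
  forall B, (forall i, measurable (B i)) ->
    (\int[P]_w (W w * noise_box s B w)%:E =
     (Ex P W * \prod_(i <- s) fine (gauss (B i)))%:E)%E.

Lemma noise_box01 s B w : 0 <= noise_box s B w <= 1.
Proof.
rewrite prodr_ge0 /=; last by move=> i _; rewrite indicE.
apply: prodr_ile1 => i _; rewrite indicE ler0n.
by case: (_ \in _); rewrite ?lexx ?ler01.
Qed.

Lemma measurable_noise_box s B :
  (forall i, measurable (B i)) -> measurable_fun setT (noise_box s B).
Proof.
move=> mB; apply: measurable_prod => i _.
by apply: measurableT_comp => //; exact: measurable_indic.
Qed.

Lemma ExE W : P.-integrable setT (EFin \o W) ->
  (\int[P]_w (W w)%:E = (Ex P W)%:E)%E.
Proof. by move=> iW; rewrite /Ex fineK //; exact: integrable_fin_num iW. Qed.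

Lemma integrable_mul_noise_box W s B : (forall i, measurable (B i)) ->
  P.-integrable setT (EFin \o W) ->
  P.-integrable setT (EFin \o (fun w => W w * noise_box s B w)).
Proof.
move=> mB iW; have mW : measurable_fun setT W.
  exact/measurable_EFinP/(measurable_int P).
apply: (le_integrable measurableT _ _ iW) => /=.
  by apply/measurable_EFinP/measurable_funM => //; exact: measurable_noise_box.
move=> w _; rewrite lee_fin normrM ler_piMr //.
by have /andP[h0 h1] := noise_box01 s B w; rewrite ger0_norm.
Qed.

(** The transfer lemma along [Z_k] with weight [W * noise_box s B]. Letting the box over [s] be
    arbitrary records that the coordinates in [s] stay independent once [v (Z_k)] joins the
    weight. *)
Lemma gauss_transfer_noise W (v : R -> R) k s B : k \notin s ->
  indep_noise W (k :: s) -> indep_noise (fun w => `|W w|) (k :: s) ->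
  gauss.-integrable setT (EFin \o v) -> (forall i, measurable (B i)) ->
  P.-integrable setT (fun w => (W w * noise_box s B w * v (tnth (Z w) k))%:E) /\
  (\int[P]_w (W w * noise_box s B w * v (tnth (Z w) k))%:E =
   (Ex P W * Ex gauss v * \prod_(i <- s) fine (gauss (B i)))%:E)%E.
Proof.
move=> ks [iW HW] [iW' HW'] iv mB.
(* Since [k] is not in [s], replacing the side at [k] by [C] leaves the box over [s] unchanged. *)
have box C w : noise_box (k :: s) (fun i => if i == k then C else B i) w =
    noise_box s B w * \1_C (tnth (Z w) k).
  rewrite /noise_box big_cons eqxx mulrC; congr (_ * _).
  by apply: eq_big_seq => i is_; case: eqP is_ ks => // -> ->.
have prodE C : \prod_(i <- k :: s) fine (gauss (if i == k then C else B i)) =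
    \prod_(i <- s) fine (gauss (B i)) * fine (gauss C).
  rewrite big_cons eqxx mulrC; congr (_ * _).
  by apply: eq_big_seq => i is_; case: eqP is_ ks => // -> ->.
have mB' C : measurable C -> forall i, measurable (if i == k then C else B i).
  by move=> mC i; case: ifP.
have gfin C : measurable C -> gauss C = (fine (gauss C))%:E.
  by move=> mC; rewrite fineK // fin_num_measure.
have [] := @integral_transfer _ _ _ _ R P gauss _ (@mZi k)
  (fun w => W w * noise_box s B w) v
  (Ex P W * \prod_(i <- s) fine (gauss (B i)))
  (Ex P (fun w => `|W w|) * \prod_(i <- s) fine (gauss (B i))).
- exact: integrable_mul_noise_box.
- move=> C mC; rewrite [X in _ = (_ * X)%E]gfin // -EFinM -mulrA -prodE.
  rewrite -HW; last exact: mB'.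
  by apply: eq_integral => w _; rewrite box mulrA.
- move=> C mC; rewrite [X in _ = (_ * X)%E]gfin // -EFinM -mulrA -prodE.
  rewrite -HW'; last exact: mB'.
  apply: eq_integral => w _; rewrite box mulrA normrM.
  by rewrite (@ger0_norm _ (noise_box _ _ _)) //; case/andP: (noise_box01 s B w).
- exact: probability_setT.
- exact: iv.
move=> i1 ->; split => //.
have -> : (\int[gauss]_t (v t)%:E)%E = (Ex gauss v)%:E.
  by rewrite /Ex fineK //; exact: (integrable_fin_num measurableT iv).
by rewrite -EFinM mulrAC.
Qed.

Lemma noise_box_setT s w : noise_box s (fun=> setT) w = 1.
Proof. by rewrite /noise_box big1 // => i _; rewrite indicT. Qed.

Lemma indep_noise_mul W (v : R -> R) k s : k \notin s ->
  indep_noise W (k :: s) -> indep_noise (fun w => `|W w|) (k :: s) ->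
  gauss.-integrable setT (EFin \o v) ->
  indep_noise (fun w => W w * v (tnth (Z w) k)) s /\
  Ex P (fun w => W w * v (tnth (Z w) k)) = Ex P W * Ex gauss v.
Proof.
move=> ks iW iW' iv.
have boxT w : W w * noise_box s (fun=> setT) w * v (tnth (Z w) k) =
   W w * v (tnth (Z w) k) by rewrite noise_box_setT mulr1.
have [] := gauss_transfer_noise ks iW iW' iv (fun=> measurableT).
under eq_fun do rewrite boxT.
rewrite big1 ?mulr1; last by move=> i _; rewrite probability_setT.
move=> i1 E1.
have E2 : Ex P (fun w => W w * v (tnth (Z w) k)) = Ex P W * Ex gauss v.
  by rewrite [LHS]/Ex E1.
split=> //; split=> // B mB; rewrite E2.
have [_ <-] := gauss_transfer_noise ks iW iW' iv mB.
by apply: eq_integral => w _; rewrite mulrAC.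
Qed.

(** Induction on [s] for all weights [W]: each step moves one factor into the weight. The hypothesis
    on [|W|] is carried along because the transfer lemma needs it at every step. *)
Lemma Ex_prod_noise W (v : 'I_N -> R -> R) s : uniq s ->
  indep_noise W s -> indep_noise (fun w => `|W w|) s ->
  (forall i, gauss.-integrable setT (EFin \o v i)) ->
  P.-integrable setT
    (EFin \o (fun w => W w * \prod_(i <- s) v i (tnth (Z w) i))) /\
  Ex P (fun w => W w * \prod_(i <- s) v i (tnth (Z w) i)) =
  Ex P W * \prod_(i <- s) Ex gauss (v i).
Proof.
elim: s W => [|k s IHs] W /=.
  move=> _ [iW _] _ _; rewrite big_nil mulr1.
  rewrite (_ : (fun w => _) = W) //.
  by apply/funext => w; rewrite big_nil mulr1.
move=> /andP[ks us] iW iW' iv.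
have [i1 E1] := indep_noise_mul ks iW iW' (iv k).
have iW'' : indep_noise (fun w => `| `|W w| |) (k :: s).
  by under eq_fun do rewrite normr_id.
have iv' : gauss.-integrable setT (EFin \o (fun t => `|v k t|)).
  exact: (integrable_abse (iv k)).
have [i2 _] := indep_noise_mul ks iW' iW'' iv'.
have i2' : indep_noise (fun w => `|W w * v k (tnth (Z w) k)|) s.
  by under eq_fun do rewrite normrM.
have [i3 E3] := IHs _ us i1 i2' iv.
rewrite big_cons mulrA -E1 -E3.
have -> : (fun w => W w * \prod_(i <- k :: s) v i (tnth (Z w) i)) =
    fun w => W w * v k (tnth (Z w) k) * \prod_(i <- s) v i (tnth (Z w) i).
  by apply/funext => w; rewrite big_cons mulrA.
by split.
Qed.

Variable X : T -> N.-tuple R.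
Hypothesis mX : measurable_fun setT X.
Hypothesis XZ : forall (A : set (N.-tuple R)) B,
  measurable A -> (forall i, measurable (B i)) ->
  P (X @^-1` A `&` [set w | forall i, B i (tnth (Z w) i)]) =
  (P (X @^-1` A) * \prod_(i < N) gauss (B i))%E.

(** The roles are exchanged: the noise box is the bounded weight and [X] the transferred variable.
    This extends independence on rectangles from indicators of [X] to integrable [u (X)]. *)
Lemma indep_noise_signal (u : N.-tuple R -> R) : measurable_fun setT u ->
  P.-integrable setT (EFin \o (u \o X)) ->
  indep_noise (u \o X) (index_enum 'I_N).
Proof.
move=> mu_ iu; split=> // B mB.
set c := \prod_(i <- _) _.
have cE : (\prod_(i < N) gauss (B i) = c%:E)%E.
  rewrite /c; elim/big_rec2 : _ => // i y1 y2 _ ->.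
  have h : gauss (B i) \is a fin_num by rewrite fin_num_measure //; exact: mB.
  by rewrite -[in LHS](fineK h).
have mXA A : measurable A -> measurable (X @^-1` A).
  by move=> mA; rewrite -[X in measurable X]setTI; exact: mX.
have mZB : measurable [set w | forall i, B i (tnth (Z w) i)].
  rewrite (_ : mkset _ = \bigcap_(i in setT) ((fun w => tnth (Z w) i) @^-1` B i)).
    apply: fin_bigcap_measurable => // i _.
    by rewrite -[X in measurable X]setTI; exact: mZi.
  by apply/seteqP; split => [w H i _|w H i]; [exact: H|exact: (H i)].
pose X' : {RV P >-> N.-tuple R} :=
  MeasurableFun.Pack (MeasurableFun.Class (isMeasurableFun.Build _ _ _ _ _ mX)).
have H A : measurable A ->
    (\int[P]_w (noise_box (index_enum 'I_N) B w * \1_A (X w))%:E =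
     c%:E * distribution P X' A)%E.
  move=> mA; rewrite muleC /distribution /pushforward /= -cE -XZ //.
  set S := X @^-1` A `&` _.
  transitivity (\int[P]_w (\1_S w)%:E)%E; last first.
    by rewrite integral_indic // ?setIT //; apply: measurableI => //; exact: mXA.
  apply: eq_integral => w _; congr EFin.
  rewrite indicI /= mulrC; congr (_ * _).
  rewrite /noise_box indicE; case: (boolP (w \in _)) => [|/negP]; rewrite inE /= => h.
    by rewrite big1 // => i _; rewrite indicE mem_set.
  have /existsNP[i hi] := h.
  by rewrite (bigD1 i) //= indicE memNset ?mul0r.
have muE : measurable_fun setT (EFin \o u : _ -> \bar R) by exact/measurable_EFinP.
have iu' : (distribution P X').-integrable setT (EFin \o u).
  apply/integrableP; split=> //.
  rewrite ge0_integral_distribution //; last exact: measurableT_comp.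
  by have /integrableP[] := iu.
have [] := @integral_transfer _ _ _ _ R P (distribution P X') _ mX
  (noise_box (index_enum 'I_N) B) u c c.
- apply: (le_integrable measurableT _ _ (finite_measure_integrable_cst P 1 _)) => //.
    by apply/measurable_EFinP; exact: measurable_noise_box.
  move=> w _; have /andP[h0 h1] := noise_box01 (index_enum 'I_N) B w.
  by rewrite /= lee_fin normr1 ger0_norm.
- exact: H.
- move=> A mA; rewrite -H //; apply: eq_integral => w _.
  by have /andP[h0 _] := noise_box01 (index_enum 'I_N) B w; rewrite ger0_norm.
- exact: probability_setT.
- exact: iu'.
move=> _ E1; under eq_integral do rewrite mulrC; rewrite E1.
by rewrite integral_distribution // ExE // -EFinM mulrC.
Qed.

Lemma Ex_signal_noise (u : N.-tuple R -> R) (v : 'I_N -> R -> R) :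
  measurable_fun setT u -> P.-integrable setT (EFin \o (u \o X)) ->
  (forall i, gauss.-integrable setT (EFin \o v i)) ->
  P.-integrable setT (EFin \o (fun w => u (X w) * \prod_i v i (tnth (Z w) i))) /\
  Ex P (fun w => u (X w) * \prod_i v i (tnth (Z w) i)) =
  Ex P (u \o X) * \prod_i Ex gauss (v i).
Proof.
move=> mu_ iu iv; apply: Ex_prod_noise => //.
- exact: index_enum_uniq.
- exact: indep_noise_signal.
- apply: (@indep_noise_signal (fun y => `|u y|)).
    exact: measurableT_comp.
  exact: (integrable_abse iu).
Qed.

End Independence.

(** * The recursion of [kappa] read as a moment expansion *)

Section KappaRecursion.
Set Implicit Arguments.
Unset Strict Implicit.
Context d (T : measurableType d) (R : realType) (P : probability T R) (N : nat).
Variables (X : T -> N.-tuple R) (x : T -> R).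
Implicit Types (a b : mpoly.multinom N).

Lemma Ex_cst (c : R) : Ex P (cst c) = c.
Proof.
transitivity (fine (\int[P]_w (cst c%:E w))%E) => //.
rewrite integral_cst //; transitivity (fine (c%:E * 1)%E); last by rewrite mule1.
by congr (fine (_ * _)%E); exact: probability_setT.
Qed.

Lemma mleP a b : reflect (forall i, mnm a i <= mnm b i)%N (mle a b).
Proof. exact: forallP. Qed.

Lemma mle_mdeg a b : mle a b -> (mpoly.mdeg a <= mpoly.mdeg b)%N.
Proof. by move=> /mleP ab; rewrite !mpoly.mdegE; apply: leq_sum => i _; exact: ab. Qed.

Lemma mle_mdeg_lt a b : mle a b -> a != b -> (mpoly.mdeg a < mpoly.mdeg b)%N.
Proof.
move=> /mleP ab; rewrite !mpoly.mdegE; apply: contraNT; rewrite -leqNgt => h.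
have [le_ab eq_ab] := leqif_sum (fun i (_ : true) => leqif_eq (ab i)).
apply/eqP/mpoly.mnmP => i; apply/eqP.
have /forall_inP/(_ i isT) // : [forall (i | true), mnm a i == mnm b i].
by rewrite -eq_ab eqn_leq le_ab.
Qed.

(** Every recursive call strictly lowers the degree. In degree 0 no smaller exponent exists, so
    exhausted fuel already gives the right value. *)
Lemma kappa_fuel_indep n m a : (mpoly.mdeg a <= n)%N -> (mpoly.mdeg a <= m)%N ->
  kappa_fuel P X x n a = kappa_fuel P X x m a.
Proof.
have fuel0 k c : mpoly.mdeg c = 0%N -> kappa_fuel P X x k c = kappa_fuel P X x 0 c.
  move=> c0; case: k => //= k; rewrite big1 ?subr0 // => b /andP[bc nbc].
  by have := mle_mdeg_lt bc nbc; rewrite [X in (_ < X)%N]c0.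
elim: n m a => [|n IHn] m a.
  by rewrite leqn0 => /eqP a0 _; rewrite [RHS]fuel0.
case: m => [|m] an; first by rewrite leqn0 => /eqP a0; rewrite fuel0.
move=> am /=; congr (_ - _); apply: eq_bigr => b /andP[ba nba].
have blt := mle_mdeg_lt ba nba.
by rewrite (IHn m) // -ltnS (leq_trans blt).
Qed.

(** The index types differ, so the sums are compared through the lists of underlying monomials where
    [F] is nonzero. *)
Lemma big_bmultinom A B (F : mpoly.multinom N -> R) :
  (forall a, F a != 0 -> (mpoly.mdeg a < A)%N && (mpoly.mdeg a < B)%N) ->
  \sum_(b : mpoly.bmultinom N A) F b = \sum_(b : mpoly.bmultinom N B) F b.
Proof.
move=> HF.
have E C : \sum_(b : mpoly.bmultinom N C) F b =
    \sum_(a <- [seq a <- map val (index_enum (mpoly.bmultinom N C)) | F a != 0]) F a.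
  rewrite big_filter big_map [RHS]big_mkcond; apply: eq_bigr => b _.
  by case: eqP => [->|].
rewrite !E; apply: perm_big; apply: uniq_perm => [||a].
- by rewrite filter_uniq // map_inj_uniq ?index_enum_uniq //; exact: val_inj.
- by rewrite filter_uniq // map_inj_uniq ?index_enum_uniq //; exact: val_inj.
rewrite !mem_filter; case: (boolP (F a != 0)) => //= /HF /andP[aA aB].
have inC C : (mpoly.mdeg a < C)%N ->
    a \in map val (index_enum (mpoly.bmultinom N C)).
  by move=> aC; apply/mapP; exists (mpoly.BMultinom aC) => //; rewrite mem_index_enum.
by rewrite !inC.
Qed.

Lemma mbinom_eq0 a b : ~~ mle b a -> mbinom a b = 0%N.
Proof.
rewrite /mle negb_forall => /existsP[i]; rewrite -ltnNge => ab.
by rewrite /mbinom (bigD1 i) //= bin_small // mul0n.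
Qed.

(** The subtracted sum is moved to the left, and [kappa] at [a] becomes its missing term [b = a]. As
    [mbinom] vanishes unless [b <= a], the range can be the same for all [a], which later permits
    exchanging sums. *)
Lemma moment_kappa (D : nat) a : (mpoly.mdeg a <= D)%N ->
  Ex P (fun w => x w * monom a (X w)) =
  \sum_(b : mpoly.bmultinom N D.+1)
    kappa P X x b * (mbinom a b)%:R * Ex P (fun w => monom (msub a b) (X w)).
Proof.
move=> aD; pose F b := kappa P X x b * (mbinom a b)%:R *
  Ex P (fun w => monom (msub a b) (X w)).
(* One extra unit of fuel exposes the recursive clause even in degree 0. *)
have kE : kappa P X x a = kappa_fuel P X x (mpoly.mdeg a).+1 a.
  by apply: kappa_fuel_indep.
rewrite [RHS](@big_bmultinom _ (mpoly.mdeg a).+1 F); last first.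
  move=> b; rewrite /F; case: (boolP (mle b a)) => [/mle_mdeg ba _|/mbinom_eq0 ->].
    by rewrite !ltnS ba (leq_trans ba).
  by rewrite mulr0 mul0r eqxx.
pose a' := mpoly.BMultinom (ltnSn (mpoly.mdeg a)).
rewrite (bigD1 a') //= {1}/F /=.
have -> : mbinom a a = 1%N by rewrite /mbinom big1 // => i _; rewrite binn.
have -> : Ex P (fun w => monom (msub a a) (X w)) = 1.
  rewrite (_ : (fun w => _) = cst 1); last first.
    apply/funext => w; rewrite /monom big1 // => i _.
    by rewrite /mnm /= tnth_mktuple subnn expr0.
  exact: Ex_cst.
rewrite !mulr1 kE /=; set S := (X in _ - X).
suff -> : S = \sum_(i | i != a') F i by rewrite subrK.
rewrite /S [RHS](bigID (fun b : mpoly.bmultinom N (mpoly.mdeg a).+1 => mle b a)) /=.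
rewrite [X in _ = _ + X]big1 ?addr0.
  apply: eq_big => [b|b /andP[ba _]].
    by rewrite andbC.
  by rewrite /F (@kappa_fuel_indep _ (mpoly.mdeg b)) // mle_mdeg.
by move=> b /andP[_ /mbinom_eq0 h]; rewrite /F h mulr0 mul0r.
Qed.

End KappaRecursion.

(** * The Gaussian noise model and the correlation bound *)

Section Estimation.
Set Implicit Arguments.
Unset Strict Implicit.
Context d (T : measurableType d) (R : realType) (P : probability T R) (N : nat).
Variables (X Z : T -> N.-tuple R) (x : T -> R) (g : N.-tuple R -> R).
Hypothesis mX : measurable_fun setT X.
Hypothesis mZ : measurable_fun setT Z.
Hypothesis mg : measurable_fun setT g.
Hypothesis xg : x = g \o X.
Hypothesis moments : forall (k : nat) (a : mpoly.multinom N),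
  P.-integrable setT (fun w => (x w ^+ k * monom a (X w))%:E).
Hypothesis XZ : forall (A : set (N.-tuple R)) (B : 'I_N -> set R),
  measurable A -> (forall i, measurable (B i)) ->
  P (X @^-1` A `&` [set w | forall i, B i (tnth (Z w) i)]) =
  (P (X @^-1` A) * \prod_(i < N) normal_prob 0 1 (B i))%E.
Implicit Types (a b : mpoly.multinom N) (F G : T -> R).

Local Notation integrable_rv F := (P.-integrable setT (EFin \o F)).

Lemma ExD F G : integrable_rv F -> integrable_rv G ->
  Ex P (fun w => F w + G w) = Ex P F + Ex P G.
Proof.
move=> iF iG; apply: EFin_inj; rewrite EFinD -!ExE //.
  by rewrite -integralD.
exact: integrableD iF iG.
Qed.

Lemma integrable_scale c F : integrable_rv F -> integrable_rv (fun w => c * F w).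
Proof. by move=> iF; exact: integrableZl iF. Qed.

Lemma ExZ c F : integrable_rv F -> Ex P (fun w => c * F w) = c * Ex P F.
Proof.
move=> iF; apply: EFin_inj; rewrite EFinM -!ExE //; last exact: integrable_scale.
by rewrite -integralZl.
Qed.

Lemma integrable_bigsum (I : Type) (r : seq I) (F : I -> T -> R) :
  (forall i, integrable_rv (F i)) -> integrable_rv (fun w => \sum_(i <- r) F i w).
Proof.
move=> iF; rewrite (_ : EFin \o _ = fun w => \sum_(i <- r) (F i w)%:E)%E.
  by apply: integrable_sum => // i _; exact: iF.
by apply/funext => w /=; rewrite sumEFin.
Qed.

Lemma Ex_sum (I : Type) (r : seq I) (F : I -> T -> R) :
  (forall i, integrable_rv (F i)) ->
  Ex P (fun w => \sum_(i <- r) F i w) = \sum_(i <- r) Ex P (F i).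
Proof.
move=> iF; elim: r => [|i r IHr].
  rewrite big_nil (_ : (fun w => _) = cst 0) ?Ex_cst //.
  by apply/funext => w; rewrite big_nil.
rewrite big_cons -IHr -ExD //; last exact: integrable_bigsum.
by congr (Ex P _); apply/funext => w; rewrite big_cons.
Qed.

Lemma Ex_signal_poly k a (q : 'I_N -> {poly R}) :
  integrable_rv (fun w => x w ^+ k * monom a (X w) * \prod_i (q i).[tnth (Z w) i]) /\
  Ex P (fun w => x w ^+ k * monom a (X w) * \prod_i (q i).[tnth (Z w) i]) =
  Ex P (fun w => x w ^+ k * monom a (X w)) * \prod_i gmean (q i).
Proof.
pose u v := g v ^+ k * monom a v.
have uE w : x w ^+ k * monom a (X w) = u (X w) by rewrite /u xg.
have mu_ : measurable_fun setT u.
  apply: measurable_funM; first exact: measurable_funX.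
  rewrite /monom; apply: measurable_prod => i _; apply: measurable_funX.
  exact: measurable_tnth.
have iu : integrable_rv (u \o X).
  rewrite (_ : EFin \o _ = fun w => (x w ^+ k * monom a (X w))%:E) //.
  by apply/funext => w; rewrite /= -uE.
have [] := @Ex_signal_noise _ _ _ P N Z mZ X mX XZ u (fun i => horner (q i)) mu_ iu.
  by move=> i; exact: integrable_gauss_poly.
have -> : (fun w => u (X w) * \prod_i (q i).[tnth (Z w) i]) =
    fun w => x w ^+ k * monom a (X w) * \prod_i (q i).[tnth (Z w) i].
  by apply/funext => w; rewrite uE.
have -> : (u \o X) = fun w => x w ^+ k * monom a (X w).
  by apply/funext => w; rewrite uE.
by [].
Qed.

(** A class of integrable variables closed under sums and products, which discharges the
    integrability conditions below. Explicit lists of terms make closure under products a list of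
    pairs. *)
Definition polynomial_rv F :=
  exists s : seq (R * (nat * mpoly.multinom N * mpoly.multinom N)), forall w,
    F w = \sum_(t <- s)
      t.1 * (x w ^+ t.2.1.1 * monom t.2.1.2 (X w) * monom t.2.2 (Z w)).

Lemma polynomial_rv_integrable F : polynomial_rv F -> integrable_rv F.
Proof.
case=> s /funext ->.
apply: integrable_bigsum => -[c [[k a] b]] /=; apply: integrable_scale.
have [h _] := Ex_signal_poly k a (fun i => 'X^(mnm b i)).
have -> : (fun w => x w ^+ k * monom a (X w) * monom b (Z w)) =
    (fun w => x w ^+ k * monom a (X w) * \prod_i 'X^(mnm b i).[tnth (Z w) i]).
  by apply/funext => w; congr (_ * _); apply: eq_bigr => i _; rewrite hornerXn.
exact: h.
Qed.

Lemma monomD a b (v : N.-tuple R) :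
  monom (mpoly.mnm_add a b) v = monom a v * monom b v.
Proof.
rewrite /monom -big_split; apply: eq_bigr => i _ /=.
by rewrite /mnm tnth_mktuple exprD.
Qed.

Lemma monom0 (v : N.-tuple R) : monom (@mpoly.mnm0 N) v = 1.
Proof. by rewrite /monom big1 // => i _; rewrite /mnm tnth_mktuple. Qed.

Lemma polynomial_rvD F G : polynomial_rv F -> polynomial_rv G ->
  polynomial_rv (fun w => F w + G w).
Proof.
by move=> [s Fs] [t Gt]; exists (s ++ t) => w; rewrite big_cat Fs Gt.
Qed.

Lemma polynomial_rvM F G : polynomial_rv F -> polynomial_rv G ->
  polynomial_rv (fun w => F w * G w).
Proof.
move=> [s Fs] [t Gt].
exists [seq (p.1 * q.1, ((p.2.1.1 + q.2.1.1)%N, mpoly.mnm_add p.2.1.2 q.2.1.2,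
             mpoly.mnm_add p.2.2 q.2.2)) | p <- s, q <- t] => w.
rewrite Fs Gt big_allpairs_dep mulr_suml; apply: eq_bigr => p _.
rewrite mulr_sumr; apply: eq_bigr => q _ /=.
by rewrite !monomD exprD; ring.
Qed.

Lemma polynomial_rv_monom k a b :
  polynomial_rv (fun w => x w ^+ k * monom a (X w) * monom b (Z w)).
Proof. by exists [:: (1, (k, a, b))] => w; rewrite big_seq1 mul1r. Qed.

Lemma polynomial_rv_cst c : polynomial_rv (fun=> c).
Proof.
exists [:: (c, (0%N, @mpoly.mnm0 N, @mpoly.mnm0 N))] => w.
by rewrite big_seq1 /= !monom0 expr0 !mulr1.
Qed.

Lemma polynomial_rv_x : polynomial_rv x.
Proof.
rewrite (_ : x = fun w => x w ^+ 1 *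
    monom (@mpoly.mnm0 N) (X w) * monom (@mpoly.mnm0 N) (Z w)).
  exact: polynomial_rv_monom.
by apply/funext => w; rewrite !monom0 !mulr1.
Qed.

Lemma monomU i (v : N.-tuple R) : monom (mpoly.mnm1 i) v = tnth v i.
Proof.
rewrite /monom (bigD1 i) //= big1 ?mulr1 => [|j ji].
  by rewrite /mnm tnth_mktuple eqxx.
by rewrite /mnm tnth_mktuple eq_sym (negbTE ji).
Qed.

Lemma polynomial_rv_X i : polynomial_rv (fun w => tnth (X w) i).
Proof.
rewrite (_ : (fun w => _) = fun w => x w ^+ 0 *
    monom (mpoly.mnm1 i) (X w) * monom (@mpoly.mnm0 N) (Z w)).
  exact: polynomial_rv_monom.
by apply/funext => w; rewrite monomU monom0 mul1r mulr1.
Qed.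

Lemma polynomial_rv_Z i : polynomial_rv (fun w => tnth (Z w) i).
Proof.
rewrite (_ : (fun w => _) = fun w => x w ^+ 0 *
    monom (@mpoly.mnm0 N) (X w) * monom (mpoly.mnm1 i) (Z w)).
  exact: polynomial_rv_monom.
by apply/funext => w; rewrite monomU monom0 !mul1r.
Qed.

Lemma polynomial_rvX F n : polynomial_rv F -> polynomial_rv (fun w => F w ^+ n).
Proof.
move=> pF; elim: n => [|n IHn]; first exact: polynomial_rv_cst.
rewrite (_ : (fun w => _) = fun w => F w * F w ^+ n); first exact: polynomial_rvM.
by apply/funext => w; rewrite exprS.
Qed.

Lemma polynomial_rv_sum (I : Type) (r : seq I) (F : I -> T -> R) :
  (forall i, polynomial_rv (F i)) -> polynomial_rv (fun w => \sum_(i <- r) F i w).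
Proof.
move=> pF; elim: r => [|i r IHr].
  rewrite (_ : (fun w => _) = fun=> 0); first exact: polynomial_rv_cst.
  by apply/funext => w; rewrite big_nil.
rewrite (_ : (fun w => _) = fun w => F i w + \sum_(i <- r) F i w).
  exact: polynomial_rvD.
by apply/funext => w; rewrite big_cons.
Qed.

Lemma polynomial_rv_prod (I : Type) (r : seq I) (F : I -> T -> R) :
  (forall i, polynomial_rv (F i)) -> polynomial_rv (fun w => \prod_(i <- r) F i w).
Proof.
move=> pF; elim: r => [|i r IHr].
  rewrite (_ : (fun w => _) = fun=> 1); first exact: polynomial_rv_cst.
  by apply/funext => w; rewrite big_nil.
rewrite (_ : (fun w => _) = fun w => F i w * \prod_(i <- r) F i w).
  exact: polynomial_rvM.
by apply/funext => w; rewrite big_cons.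
Qed.

Lemma polynomial_rv_horner F (q : {poly R}) :
  polynomial_rv F -> polynomial_rv (fun w => q.[F w]).
Proof.
move=> pF; rewrite (_ : (fun w => _) = fun w => \sum_(i < size q) q`_i * F w ^+ i).
  apply: polynomial_rv_sum => i; apply: polynomial_rvM.
    exact: polynomial_rv_cst.
  exact: polynomial_rvX.
by apply/funext => w; rewrite horner_coef.
Qed.

(** Distributing the product over the sums picks one index [f i] per coordinate, and signal and
    noise factor in each term. With constant [q] the same formula also expands expressions free of
    noise. *)
Lemma Ex_expand k K (e : 'I_N -> nat -> nat) (q : 'I_N -> nat -> {poly R}) :
  Ex P (fun w => x w ^+ k *
    \prod_i \sum_(j < K) tnth (X w) i ^+ e i j * (q i j).[tnth (Z w) i]) =
  \sum_(f : {ffun 'I_N -> 'I_K})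
    Ex P (fun w => x w ^+ k * \prod_i tnth (X w) i ^+ e i (f i)) *
    \prod_i gmean (q i (f i)).
Proof.
pose m (f : {ffun 'I_N -> 'I_K}) : mpoly.multinom N :=
  mpoly.Multinom [tuple e i (f i) | i < N].
have mE f w : monom (m f) (X w) = \prod_i tnth (X w) i ^+ e i (f i).
  by apply: eq_bigr => i _; rewrite /mnm tnth_mktuple.
rewrite (_ : (fun w => _) = fun w => \sum_(f : {ffun 'I_N -> 'I_K})
    x w ^+ k * monom (m f) (X w) * \prod_i (q i (f i)).[tnth (Z w) i]); last first.
  apply/funext => w; rewrite bigA_distr_bigA mulr_sumr.
  by apply: eq_bigr => f _; rewrite -mulrA big_split mE.
rewrite Ex_sum; last by move=> f; exact: (Ex_signal_poly k (m f) _).1.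
apply: eq_bigr => f _; rewrite (Ex_signal_poly k (m f) (fun i => q i (f i))).2.
by congr (Ex P _ * _); apply/funext => w; rewrite mE.
Qed.

Definition hermite_rv b (w : T) : R := \prod_i (hermite R (mnm b i)).[tnth (Z w) i].

Lemma polynomial_rv_hermite b : polynomial_rv (hermite_rv b).
Proof.
apply: polynomial_rv_prod => i; apply: polynomial_rv_horner.
exact: polynomial_rv_Z.
Qed.

Lemma Ex_hermite_rv b c :
  Ex P (fun w => hermite_rv b w * hermite_rv c w) = (mfact c * (b == c))%:R.
Proof.
have [_] := Ex_signal_poly 0 (@mpoly.mnm0 N)
  (fun i => hermite R (mnm b i) * hermite R (mnm c i)).
rewrite (_ : (fun w => x w ^+ 0 * monom _ (X w)) = cst 1); last first.
  by apply/funext => w; rewrite monom0 mul1r.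
rewrite Ex_cst mul1r; under eq_bigr do rewrite gmean_hermite_orthogonal.
rewrite (_ : (fun w => _) = fun w => hermite_rv b w * hermite_rv c w); last first.
  apply/funext => w; rewrite monom0 !mul1r -big_split.
  by apply: eq_bigr => i _ /=; rewrite hornerM.
move=> ->; rewrite -natr_prod; congr _%:R; have [->|bc] := eqVneq b c.
  by rewrite muln1 /mfact; apply: eq_bigr => i _; rewrite eqxx muln1.
rewrite muln0; apply/eqP; apply: contraNT bc; rewrite -lt0n => h.
apply/eqP/mpoly.mnmP => i; apply/eqP; move: h.
by rewrite (bigD1 i) //= muln_gt0 muln_gt0; case: eqP => //; rewrite andbF.
Qed.

Variable D : nat.

Lemma mnm_lt a i : (mpoly.mdeg a <= D)%N -> (mnm a i < D.+1)%N.
Proof.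
by rewrite mpoly.mdegE (bigD1 i) //= ltnS; apply: leq_trans; rewrite leq_addr.
Qed.

Lemma gmeanC (c : R) : gmean c%:P = c.
Proof. by rewrite -alg_polyC linearZ /= gmean1 mulr1. Qed.

(** The binomial theorem per coordinate, padded by zero terms to the common range [D.+1] that
    [Ex_expand] requires. *)
Lemma observation_power a w : (mpoly.mdeg a <= D)%N ->
  \prod_i tnth (addt (X w) (Z w)) i ^+ mnm a i =
  \prod_i \sum_(j < D.+1) tnth (X w) i ^+ j *
     ('C(mnm a i, j)%:R *: 'X^(mnm a i - j)).[tnth (Z w) i].
Proof.
move=> aD; apply: eq_bigr => i _; rewrite tnth_mktuple addrC exprDn.
set n := mnm a i; have nD : (n < D.+1)%N by exact: mnm_lt.
rewrite (big_ord_widen D.+1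
  (fun j => tnth (Z w) i ^+ (n - j) * tnth (X w) i ^+ j *+ 'C(n, j))) //.
rewrite big_mkcond; apply: eq_bigr => j _.
rewrite hornerZ hornerXn -mulr_natl; case: ltnP => [_|nj]; first by ring.
by rewrite bin_small // mul0r mulr0.
Qed.

(** The expectation on the right is [1 / b!] times that of the [b]-th derivative of [Y^a], with the
    noise already averaged out. It arises by applying [moment_kappa] to each monomial of [X] in the
    expansion of [Y^a]. *)
Lemma Ex_x_observation_power a : (mpoly.mdeg a <= D)%N ->
  Ex P (fun w => x w * \prod_i tnth (addt (X w) (Z w)) i ^+ mnm a i) =
  \sum_(b : mpoly.bmultinom N D.+1) kappa P X x b *
    Ex P (fun w => \prod_i \sum_(j < D.+1) tnth (X w) i ^+ (j - mnm b i) *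
      ('C(j, mnm b i) * 'C(mnm a i, j))%:R * gmean 'X^(mnm a i - j)).
Proof.
move=> aD.
transitivity (Ex P (fun w => x w ^+ 1 *
    \prod_i \sum_(j < D.+1) tnth (X w) i ^+ j *
     ('C(mnm a i, j)%:R *: 'X^(mnm a i - j)).[tnth (Z w) i])).
  by congr (Ex P _); apply/funext => w; rewrite observation_power.
rewrite (Ex_expand 1 D.+1 (fun _ j => j)
  (fun i j => 'C(mnm a i, j)%:R *: 'X^(mnm a i - j))).
(* The right side is expanded over the same choices [f], its numerical coefficients being encoded as
   constant polynomials. *)
transitivity (\sum_(b : mpoly.bmultinom N D.+1) kappa P X x b *
   \sum_(f : {ffun 'I_N -> 'I_D.+1})
     Ex P (fun w => x w ^+ 0 * \prod_i tnth (X w) i ^+ (f i - mnm b i)) *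
     \prod_i gmean (('C(f i, mnm b i) * 'C(mnm a i, f i))%:R *
       gmean 'X^(mnm a i - f i))%:P); last first.
  apply: eq_bigr => b _; congr (_ * _).
  rewrite -(Ex_expand 0 D.+1 (fun i j => (j - mnm b i)%N)
    (fun i j => (('C(j, mnm b i) * 'C(mnm a i, j))%:R * gmean 'X^(mnm a i - j))%:P)).
  congr (Ex P _); apply/funext => w; rewrite mul1r; apply: eq_bigr => i _.
  by apply: eq_bigr => j _; rewrite hornerC mulrA.
under [RHS]eq_bigr do rewrite mulr_sumr.
rewrite exchange_big; apply: eq_bigr => f _ /=.
pose m : mpoly.multinom N := mpoly.Multinom [tuple (f i : nat) | i < N].
have mE i : mnm m i = f i by rewrite /mnm tnth_mktuple.
(* If the chosen exponent is not below [a], a binomial coefficient kills both sides; otherwise its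
   degree is at most [D], as [moment_kappa] needs. *)
have [ma|] := boolP (mle m a); last first.
  rewrite negb_forall => /existsP[i]; rewrite mE -ltnNge => ai.
  rewrite (bigD1 i) //= bin_small // scale0r linear0 mul0r mulr0 big1 // => b _.
  by rewrite (bigD1 i) //= (@bin_small (mnm a i)) // muln0 mul0r gmeanC mul0r !mulr0.
have mD : (mpoly.mdeg m <= D)%N by rewrite (leq_trans (mle_mdeg ma)).
have -> : Ex P (fun w => x w ^+ 1 * \prod_i tnth (X w) i ^+ f i) =
    Ex P (fun w => x w * monom m (X w)).
  congr (Ex P _); apply/funext => w; rewrite expr1 /monom.
  by under [in RHS]eq_bigr do rewrite mE.
rewrite (moment_kappa _ _ _ mD) mulr_suml; apply: eq_bigr => b _.
have -> : (fun w => monom (msub m b) (X w)) =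
    fun w => x w ^+ 0 * \prod_i tnth (X w) i ^+ (f i - mnm b i).
  apply/funext => w; rewrite mul1r; apply: eq_bigr => i _.
  by rewrite {1}/mnm tnth_mktuple mE.
rewrite -!mulrA; congr (_ * _); rewrite mulrCA; congr (_ * _).
rewrite /mbinom natr_prod -big_split; apply: eq_bigr => i _ /=.
by rewrite mE gmeanC linearZ /= natrM mulrA.
Qed.

(** The Hermite factor differentiates the powers of [Z], while the right side differentiates those
    of [X]; [binomial_shift] identifies the two, as [Y] depends only on the sum. *)
Lemma Ex_hermite_observation_power a b : (mpoly.mdeg a <= D)%N ->
  Ex P (fun w => hermite_rv b w * \prod_i tnth (addt (X w) (Z w)) i ^+ mnm a i) =
  (mfact b)%:R *
  Ex P (fun w => \prod_i \sum_(j < D.+1) tnth (X w) i ^+ (j - mnm b i) *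
      ('C(j, mnm b i) * 'C(mnm a i, j))%:R * gmean 'X^(mnm a i - j)).
Proof.
move=> aD.
transitivity (Ex P (fun w => x w ^+ 0 * \prod_i \sum_(j < D.+1) tnth (X w) i ^+ j *
     (hermite R (mnm b i) * ('C(mnm a i, j)%:R *: 'X^(mnm a i - j))).[tnth (Z w) i])).
  congr (Ex P _); apply/funext => w; rewrite observation_power // mul1r -big_split.
  apply: eq_bigr => i _ /=; rewrite mulr_sumr; apply: eq_bigr => j _.
  by rewrite hornerM mulrCA.
rewrite (Ex_expand 0 D.+1 (fun _ j => j)
  (fun i j => hermite R (mnm b i) * ('C(mnm a i, j)%:R *: 'X^(mnm a i - j)))).
have -> : Ex P (fun w => \prod_i \sum_(j < D.+1) tnth (X w) i ^+ (j - mnm b i) *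
      ('C(j, mnm b i) * 'C(mnm a i, j))%:R * gmean 'X^(mnm a i - j)) =
  Ex P (fun w => x w ^+ 0 * \prod_i \sum_(j < D.+1) tnth (X w) i ^+ j *
     (('C(mnm a i, j) * 'C(mnm a i - j, mnm b i))%:R *
      gmean 'X^(mnm a i - j - mnm b i))%:P.[tnth (Z w) i]).
  congr (Ex P _); apply/funext => w; rewrite mul1r; apply: eq_bigr => i _.
  rewrite (binomial_shift _ (fun n => gmean 'X^n)); last exact: mnm_lt.
  by apply: eq_bigr => j _; rewrite hornerC mulrA.
rewrite (Ex_expand 0 D.+1 (fun _ j => j)
  (fun i j => (('C(mnm a i, j) * 'C(mnm a i - j, mnm b i))%:R *
      gmean 'X^(mnm a i - j - mnm b i))%:P)).
rewrite mulr_sumr; apply: eq_bigr => f _; rewrite mulrCA; congr (_ * _).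
rewrite /mfact natr_prod -big_split; apply: eq_bigr => i _ /=.
(* The falling factorial from the repeated derivative is a binomial coefficient times a factorial;
   these factorials make up [mfact b]. *)
rewrite gmeanC -scalerAr linearZ /= gmean_hermite_exp -bin_ffact !natrM; ring.
Qed.

(* The random variable [H] of the introduction. *)
Definition kappa_hermite (w : T) : R :=
  \sum_(b : mpoly.bmultinom N D.+1) kappa P X x b / (mfact b)%:R * hermite_rv b w.

Lemma mfact_neq0 b : (mfact b)%:R != 0 :> R.
Proof. by rewrite pnatr_eq0 -lt0n prodn_gt0 // => i; exact: fact_gt0. Qed.

Lemma polynomial_rv_kappa_hermite : polynomial_rv kappa_hermite.
Proof.
apply: polynomial_rv_sum => b; apply: polynomial_rvM.
  exact: polynomial_rv_cst.
exact: polynomial_rv_hermite.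
Qed.

Lemma Ex_kappa_hermite_sqr : Ex P (fun w => kappa_hermite w ^+ 2) =
  \sum_(b : mpoly.bmultinom N D.+1) kappa P X x b ^+ 2 / (mfact b)%:R.
Proof.
pose k b := kappa P X x b / (mfact b)%:R.
have iH b c : integrable_rv (fun w => hermite_rv b w * hermite_rv c w).
  apply: polynomial_rv_integrable.
  by apply: polynomial_rvM; exact: polynomial_rv_hermite.
transitivity (Ex P (fun w => \sum_(b : mpoly.bmultinom N D.+1)
    \sum_(c : mpoly.bmultinom N D.+1) k b * k c * (hermite_rv b w * hermite_rv c w))).
  congr (Ex P _); apply/funext => w; rewrite expr2 mulr_suml; apply: eq_bigr => b _.
  by rewrite mulr_sumr; apply: eq_bigr => c _; rewrite /k; ring.
rewrite Ex_sum; last first.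
  by move=> b; apply: integrable_bigsum => c; apply: integrable_scale.
apply: eq_bigr => b _; rewrite Ex_sum; last by move=> c; exact: integrable_scale.
rewrite (bigD1 b) //= big1 ?addr0 => [|c cb]; rewrite ExZ // Ex_hermite_rv.
  by rewrite eqxx muln1 /k; field; exact: mfact_neq0.
by rewrite eq_sym val_eqE (negbTE cb) muln0 mulr0.
Qed.

Lemma polynomial_rv_observation i : polynomial_rv (fun w => tnth (addt (X w) (Z w)) i).
Proof.
rewrite (_ : (fun w => _) = fun w => tnth (X w) i + tnth (Z w) i).
  by apply: polynomial_rvD; [exact: polynomial_rv_X|exact: polynomial_rv_Z].
by apply/funext => w; rewrite tnth_mktuple.
Qed.

Lemma polynomial_rv_observation_power a :
  polynomial_rv (fun w => \prod_i tnth (addt (X w) (Z w)) i ^+ mnm a i).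
Proof.
apply: polynomial_rv_prod => i; apply: polynomial_rvX.
exact: polynomial_rv_observation.
Qed.

Lemma Ex_kappa_hermite_power a : (mpoly.mdeg a <= D)%N ->
  Ex P (fun w => x w * \prod_i tnth (addt (X w) (Z w)) i ^+ mnm a i) =
  Ex P (fun w => kappa_hermite w * \prod_i tnth (addt (X w) (Z w)) i ^+ mnm a i).
Proof.
move=> aD; rewrite Ex_x_observation_power //.
have iH (b : mpoly.bmultinom N D.+1) :
    integrable_rv (fun w => hermite_rv b w *
      \prod_i tnth (addt (X w) (Z w)) i ^+ mnm a i).
  apply: polynomial_rv_integrable; apply: polynomial_rvM.
    exact: polynomial_rv_hermite.
  exact: polynomial_rv_observation_power.
transitivity (Ex P (fun w => \sum_(b : mpoly.bmultinom N D.+1)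
    kappa P X x b / (mfact b)%:R *
    (hermite_rv b w * \prod_i tnth (addt (X w) (Z w)) i ^+ mnm a i))); last first.
  congr (Ex P _); apply/funext => w; rewrite mulr_suml.
  by apply: eq_bigr => b _; rewrite mulrA.
rewrite Ex_sum; last by move=> b; exact: integrable_scale.
apply: eq_bigr => b _; rewrite ExZ // Ex_hermite_observation_power //.
by rewrite mulrA divfK // mfact_neq0.
Qed.

Local Notation evalY f := (fun w => mpoly.meval (tnth (addt (X w) (Z w))) f).

Lemma polynomial_rv_meval (f : mpoly.mpoly N R) : polynomial_rv (evalY f).
Proof.
rewrite (_ : evalY f = fun w => \sum_(a <- mpoly.msupp f) mpoly.mcoeff a f *
   \prod_i tnth (addt (X w) (Z w)) i ^+ mnm a i); last first.
  by apply/funext => w; rewrite mpoly.mevalE.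
apply: polynomial_rv_sum => a; apply: polynomial_rvM; first exact: polynomial_rv_cst.
exact: polynomial_rv_observation_power.
Qed.

Lemma Ex_kappa_hermite_meval (f : mpoly.mpoly N R) : (mpoly.msize f <= D.+1)%N ->
  Ex P (fun w => evalY f w * x w) = Ex P (fun w => kappa_hermite w * evalY f w).
Proof.
move=> fD.
have fE F : polynomial_rv F -> Ex P (fun w => F w * evalY f w) =
    \sum_(a <- mpoly.msupp f) mpoly.mcoeff a f *
      Ex P (fun w => F w * \prod_i tnth (addt (X w) (Z w)) i ^+ mnm a i).
  move=> pF.
  have iF a : integrable_rv (fun w => F w *
      \prod_i tnth (addt (X w) (Z w)) i ^+ mnm a i).
    apply: polynomial_rv_integrable; apply: polynomial_rvM => //.
    exact: polynomial_rv_observation_power.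
  under [RHS]eq_bigr do rewrite -ExZ //.
  rewrite -Ex_sum; last by move=> a; exact: integrable_scale.
  congr (Ex P _); apply/funext => w; rewrite mpoly.mevalE mulr_sumr.
  by apply: eq_bigr => a _; rewrite mulrCA.
rewrite (fE _ polynomial_rv_kappa_hermite).
transitivity (Ex P (fun w => x w * evalY f w)).
  by congr (Ex P _); apply/funext => w; rewrite mulrC.
rewrite (fE _ polynomial_rv_x); apply: eq_big_seq => a af.
by rewrite Ex_kappa_hermite_power // -ltnS (leq_trans (mpoly.msize_mdeg_lt af)).
Qed.

Lemma Ex_ge0 F : (forall w, 0 <= F w) -> 0 <= Ex P F.
Proof. by move=> F0; apply: fine_ge0; apply: integral_ge0 => w _; rewrite lee_fin. Qed.

Lemma Ex_cauchy_schwarz F G : polynomial_rv F -> polynomial_rv G ->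
  Ex P (fun w => G w ^+ 2) != 0 ->
  Ex P (fun w => F w * G w) ^+ 2 <=
  Ex P (fun w => F w ^+ 2) * Ex P (fun w => G w ^+ 2).
Proof.
move=> pF pG G0.
have Gp : 0 < Ex P (fun w => G w ^+ 2).
  by rewrite lt_neqAle eq_sym G0 Ex_ge0 // => w; exact: sqr_ge0.
set A := Ex P (fun w => F w ^+ 2); set B := Ex P (fun w => G w ^+ 2) in G0 Gp *.
(* This [t] minimises the mean of [(F - t * G)^2]; nonnegativity of that minimum, multiplied by [B],
   is the claim. *)
set C := Ex P (fun w => F w * G w); pose t := C / B.
have iF2 := polynomial_rv_integrable (polynomial_rvX 2 pF).
have iG2 := polynomial_rv_integrable (polynomial_rvX 2 pG).
have iFG := polynomial_rv_integrable (polynomial_rvM pF pG).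
have : 0 <= Ex P (fun w => (F w - t * G w) ^+ 2).
  by apply: Ex_ge0 => w; exact: sqr_ge0.
rewrite (_ : (fun w => _) = fun w => F w ^+ 2 +
    ((- (2 * t)) * (F w * G w) + t ^+ 2 * G w ^+ 2)); last first.
  by apply/funext => w; ring.
have i1 := integrable_scale (- (2 * t)) iFG.
have i2 := integrable_scale (t ^+ 2) iG2.
rewrite ExD //; last exact: integrableD i1 i2.
rewrite ExD // !ExZ // -/A -/B -/C => h.
rewrite -subr_ge0 (_ : A * B - C ^+ 2 = B * (A + (- (2 * t) * C + t ^+ 2 * B))).
  by rewrite mulr_ge0 // ltW.
by rewrite /t; field.
Qed.

Lemma CorrD_sqr_le :
  (CorrD P x (fun w => addt (X w) (Z w)) D * CorrD P x (fun w => addt (X w) (Z w)) D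
   <= (\sum_(b : mpoly.bmultinom N D.+1)
         kappa P X x b ^+ 2 / (mfact b)%:R)%:E)%E.
Proof.
set S := \sum_(b : _) _; set Y := fun w => addt (X w) (Z w).
have S0 : 0 <= S.
  by rewrite /S -Ex_kappa_hermite_sqr; apply: Ex_ge0 => w; exact: sqr_ge0.
have corr_le : (CorrD P x Y D <= (Num.sqrt S)%:E)%E.
  apply: ge_ereal_sup => _ [f [fD f0] <-]; rewrite lee_fin.
  have f2 : 0 < Ex P (fun w => mpoly.meval (tnth (Y w)) f ^+ 2).
    by rewrite lt_neqAle eq_sym f0 Ex_ge0 // => w; exact: sqr_ge0.
  rewrite ler_pdivrMr ?sqrtr_gt0 // -sqrtrM // (le_trans (ler_norm _)) //.
  rewrite -sqrtr_sqr ler_wsqrtr // (Ex_kappa_hermite_meval fD) /S -Ex_kappa_hermite_sqr.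
  apply: Ex_cauchy_schwarz => //; first exact: polynomial_rv_kappa_hermite.
  exact: polynomial_rv_meval.
(* Squaring the upper bound requires a nonnegative supremum: the constant polynomials 1 and -1 are
   admissible and attain [Ex P x] and its opposite. *)
have corr_ge0 : (0 <= CorrD P x Y D)%E.
  have corr_cst c : c ^+ 2 = 1 -> ((c * Ex P x)%:E <= CorrD P x Y D)%E.
    move=> c1.
    have evc w : mpoly.meval (tnth (Y w)) (mpoly.mpolyC N c) = c.
      by rewrite mpoly.mevalC.
    have E1 : Ex P (fun w => mpoly.meval (tnth (Y w)) (mpoly.mpolyC N c) ^+ 2) = 1.
      rewrite (_ : (fun w => _) = cst 1) ?Ex_cst //.
      by apply/funext => w; rewrite evc c1.
    apply: ereal_sup_ubound; exists (mpoly.mpolyC N c).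
      by split; rewrite ?E1 ?oner_eq0 // mpoly.msizeC; case: (c != 0).
    rewrite E1 sqrtr1 divr1; congr _%:E.
    rewrite -ExZ; last exact: (polynomial_rv_integrable polynomial_rv_x).
    by congr (Ex P _); apply/funext => w; rewrite evc.
  have [x0|x0] := leP 0 (Ex P x).
    by apply: le_trans (corr_cst 1 _); rewrite ?mul1r ?lee_fin ?expr1n.
  apply: le_trans (corr_cst (-1) _); last by rewrite sqrrN expr1n.
  by rewrite lee_fin mulN1r oppr_ge0 ltW.
apply: (@le_trans _ _ ((Num.sqrt S)%:E * (Num.sqrt S)%:E)%E).
  exact: lee_pmul.
by rewrite -EFinM -expr2 sqr_sqrtr.
Qed.

End Estimation.

Theorem mainTheorem1 (d : measure_display) (T : measurableType d)
  (R : realType) (P : probability T R) (N : nat)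
  (X Z : T -> N.-tuple R) (x : T -> R) :
  measurable_fun setT X ->
  measurable_fun setT Z ->
  (* x is a (measurable) scalar function of X *)
  (exists g : N.-tuple R -> R, measurable_fun setT g /\ x = g \o X) ->
  (* all moments of X, and all joint moments of x with X, are finite *)
  (forall (k : nat) (alpha : mpoly.multinom N),
      P.-integrable setT (fun w => (x w ^+ k * monom alpha (X w))%:E)) ->
  (* Z has i.i.d. N(0,1) entries and is independent of X:
     the joint law of (X, Z) is (law of X) x N(0,1)^N on measurable rectangles *)
  (forall (A : set (N.-tuple R)) (B : 'I_N -> set R),
      measurable A -> (forall i, measurable (B i)) ->
      P (X @^-1` A `&` [set w | forall i, B i (tnth (Z w) i)]) =
      (P (X @^-1` A) * \prod_(i < N) normal_prob 0 1 (B i))%E) ->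
  forall D : nat,
    (CorrD P x (fun w => addt (X w) (Z w)) D * CorrD P x (fun w => addt (X w) (Z w)) D
     <= (\sum_(alpha : mpoly.bmultinom N D.+1)
           (kappa P X x alpha) ^+ 2 / (mfact alpha)%:R)%:E)%E.
Proof.
move=> mX mZ [g [mg xg]] moments XZ D.
exact: (CorrD_sqr_le mX mZ mg xg moments XZ D).
Qed.
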